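(* Let $n\ge 2$ and let $R_n$ be the dihedral quandle on $\mathbb{Z}/n\mathbb{Z}$. Then the following statements hold: (1) The Cayley graph $\Gamma_{R_n}$ is symmetric. (2) If $n$ is odd, then $\Gamma_{R_n}$ is isomorphic to the complete directed graph $K_n$. (3) If $n$ is even, then $\Gamma_{R_n}$ has two connected components, each isomorphic to the complete directed graph $K_m$, where $m=\frac{n}{2}$.
   Context: A quandle is a set $Q$ with a binary operation $\rhd$ such that for all $x,y,z\in Q$: (1) $x\rhd x=x$; (2) for each $y$ the map $R_y(x)=x\rhd y$ is a bijection $Q\to Q$; (3) $(x\rhd y)\rhd z=(x\rhd z)\rhd(y\rhd z)$. For $n\ge2$ the dihedral quandle $R_n$ is the set $\mathbb{Z}/n\mathbb{Z}$ with operation $a\rhd b=2b-a$. All graphs are directed graphs, with loops allowed and without multiple edges, so the edge set is a subset of $V\times V$. The (right) Cayley graph $\Gamma_Q$ of a quandle $Q$ is the directed graph with vertex set $Q$ and edge set $\{(x,x\rhd y): x,y\in Q\}$. A directed graph is symmetric if whenever $(a,c)$ is an edge, so is $(c,a)$. It is connected if for every ordered pair of vertices $(u,v)$ there is a directed path from $u$ to $v$; the connected components are the maximal connected induced subgraphs. A directed graph is complete if for any two distinct vertices $a,b$ both edges $(a,b)$ and $(b,a)$ are present and there is exactly one loop at each vertex; $K_n$ denotes the complete directed graph with $n$ vertices. *)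

(* Defs.v *)
From Stdlib Require Import Relation_Operators.
From mathcomp Require Import all_boot all_order all_algebra.
From mathcomp Require Import ring.
From mathcomp Require Import classical_sets cardinality.

Set Implicit Arguments.
Unset Strict Implicit.
Unset Printing Implicit Defensive.

Import GRing.Theory.

Local Open Scope classical_set_scope.
Local Open Scope ring_scope.

Record quandle := Quandle {
  qcarrier :> Type;
  qop : qcarrier -> qcarrier -> qcarrier;
  qop_idem : forall x, qop x x = x;
  qop_bij : forall y, bijective (fun x => qop x y);
  qop_distr : forall x y z,
    qop (qop x y) z = qop (qop x z) (qop y z)
}.

Definition dihedral_op (n : nat) (a b : 'Z_n) : 'Z_n := b *+ 2 - a.

Lemma dihedral_op_idem n (x : 'Z_n) : dihedral_op x x = x.
Proof. by rewrite /dihedral_op mulr2n addrK. Qed.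

Lemma dihedral_op_bij n (y : 'Z_n) : bijective (fun x => dihedral_op x y).
Proof.
by exists (fun x => dihedral_op x y) => x; rewrite /dihedral_op subKr.
Qed.

Lemma dihedral_op_distr n (x y z : 'Z_n) :
  dihedral_op (dihedral_op x y) z =
  dihedral_op (dihedral_op x z) (dihedral_op y z).
Proof. by rewrite /dihedral_op; ring. Qed.

(* For n <= 1 the type 'Z_n is Z/2Z, so this is R_n only when 2 <= n. *)
Definition dihedral_quandle (n : nat) : quandle :=
  Quandle (@dihedral_op_idem n) (@dihedral_op_bij n) (@dihedral_op_distr n).

Record digraph := Digraph {
  vertex : Type;
  edge : vertex -> vertex -> Prop
}.

Definition cayley_graph (Q : quandle) : digraph :=
  @Digraph Q (fun x z => exists y : Q, z = qop x y).

Definition digraph_symmetric (G : digraph) : Prop :=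
  forall a c : vertex G, edge a c -> edge c a.

Definition digraph_isomorphic (G H : digraph) : Prop :=
  exists f : vertex G -> vertex H,
    bijective f /\ forall x y : vertex G, edge x y <-> edge (f x) (f y).

(* Edges form a relation, so a vertex never carries more than one loop. *)
Definition digraph_complete (G : digraph) : Prop :=
  (forall a b : vertex G, a <> b -> edge a b /\ edge b a) /\
  (forall a : vertex G, edge a a).

Definition complete_digraph (n : nat) : digraph :=
  @Digraph 'I_n (fun _ _ => True).

Lemma complete_digraphP n : digraph_complete (complete_digraph n).
Proof. by []. Qed.

Definition digraph_connected (G : digraph) : Prop :=
  forall u v : vertex G, clos_refl_trans (vertex G) (@edge G) u v.

Definition induced_subgraph (G : digraph) (S : set (vertex G)) : digraph :=
  @Digraph (set_type S) (fun x y => edge (sval x) (sval y)).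

Definition is_connected_component (G : digraph) (S : set (vertex G)) : Prop :=
  digraph_connected (induced_subgraph S) /\
  forall T : set (vertex G),
    S `<=` T -> digraph_connected (induced_subgraph T) -> T = S.

Definition connected_components (G : digraph) : set (set (vertex G)) :=
  [set S | is_connected_component S].

Arguments connected_components : clear implicits.

(* Main.v *)
(** There is an edge from [x] to [z] in the Cayley graph of [R_n] exactly when
    [x + z] is a double in [Z/n].  This condition is symmetric.  For odd [n]
    every element is a double; for even [n] the doubles are the even residues,
    so edges are exactly the pairs of equal parity, and the two parity classes
    are complete and pairwise not joined. *)

Require Import Defs.
From Stdlib Require Import Relation_Operators.
From mathcomp Require Import all_boot all_algebra.
From mathcomp Require Import classical_sets cardinality.

Set Implicit Arguments.
Unset Strict Implicit.
Unset Printing Implicit Defensive.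

Import GRing.Theory.

Local Open Scope classical_set_scope.

Lemma clos_refl_trans_invariant (T U : Type) (r : T -> T -> Prop) (f : T -> U)
    (x y : T) :
  (forall a b, r a b -> f a = f b) -> clos_refl_trans T r x y -> f x = f y.
Proof. by move=> fP; elim=> {x y} [x y /fP||x y z _ -> _ ->]. Qed.

Definition level_set (G : digraph) (c : vertex G -> bool) (b : bool) :
  set (vertex G) := [set x | c x = b].

Section TwoCompleteBlocks.

Variables (G : digraph) (c : vertex G -> bool).
Hypothesis edgeE : forall x z : vertex G, edge x z <-> c x = c z.
Hypothesis c_surj : forall b, exists x, c x = b.

Lemma level_set_connected b :
  digraph_connected (induced_subgraph (level_set c b)).
Proof.
move=> [x xb] [y yb]; apply: rt_step => /=; apply/edgeE.
by rewrite (set_mem xb) (set_mem yb).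
Qed.

(** Edges preserve [c], so [c] is constant along every path inside [T]. *)
Lemma connected_sub_level_set (T : set (vertex G)) x :
  T x -> digraph_connected (induced_subgraph T) -> T `<=` level_set c (c x).
Proof.
move=> Tx Tconn y Ty; rewrite /level_set /=.
by apply: (clos_refl_trans_invariant (f := fun u => c (sval u)) _
             (Tconn (exist _ y (mem_set Ty)) (exist _ x (mem_set Tx))))
  => u v /edgeE.
Qed.

Lemma level_set_is_component b : is_connected_component (level_set c b).
Proof.
split; first exact: level_set_connected.
move=> T sT Tconn; have [x xb] := c_surj b.
apply/seteqP; split=> //; rewrite -xb.
by apply: connected_sub_level_set => //; apply: sT.
Qed.

(** A component with a point [x] lies in the level set of [c x], which is itself connected, so
    maximality makes them equal. *)
Lemma componentP (S : set (vertex G)) :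
  is_connected_component S <-> exists b, S = level_set c b.
Proof.
split=> [[Sconn Smax]|[b ->]]; last exact: level_set_is_component.
have [S0|/set0P[x Sx]] := eqVneq S set0.
  (* Maximality excludes the empty set: it would equal any level set. *)
  exists true; apply/esym/Smax; first by rewrite S0; apply: sub0set.
  exact: level_set_connected.
exists (c x); apply/esym/Smax; first exact: connected_sub_level_set.
exact: level_set_connected.
Qed.

(** Surjectivity of [c] makes every level set nonempty, and any element of it recovers the index. *)
Lemma level_set_inj : injective (level_set c).
Proof.
move=> b b' eqS; have [x xb] := c_surj b.
by have: level_set c b' x; [rewrite -eqS | rewrite /level_set /= xb].
Qed.

Lemma connected_components_card : (connected_components G #= `I_2)%card.
Proof.
have -> : connected_components G = (fun k => level_set c (odd k)) @` `I_2.
  apply/seteqP; split=> S /=.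
    (* The witness is [b] coerced to the number 0 or 1. *)
    by move=> /componentP[b ->]; exists b; case: b.
  by move=> [k _ <-]; apply: level_set_is_component.
apply: inj_card_eq => i j; rewrite !inE /= => i2 j2 /level_set_inj.
by move: i j i2 j2 => [|[|i]] [|[|j]].
Qed.

End TwoCompleteBlocks.

Local Notation dihedral_graph n := (cayley_graph (dihedral_quandle n)).

Lemma dihedral_edgeE n (x z : vertex (dihedral_graph n.+2)) :
  edge x z <-> exists y : 'Z_n.+2, (x + z = y *+ 2)%R.
Proof.
split=> -[y].
  by rewrite /= /dihedral_op => ->; exists y; rewrite addrC subrK.
by move=> xzE; exists y; rewrite /= /dihedral_op -xzE addrC addKr.
Qed.

(** Any even natural number representing [x], reduced or not, can be halved before passing to
    residues. *)
Lemma Zp_half n (x : 'Z_n.+2) (k : nat) :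
  ~~ odd k -> (k%:R = x)%R -> exists y : 'Z_n.+2, (x = y *+ 2)%R.
Proof.
move=> k_even <-; exists (k./2%:R)%R.
by rewrite -mulrnA muln2 even_halfK.
Qed.

Lemma dihedral_edge_odd n (x z : vertex (dihedral_graph n.+2)) :
  odd n -> edge x z.
Proof.
move=> n_odd; apply/dihedral_edgeE.
(* Both [x + z] and [x + z + n.+2], computed in [nat], represent the sum; as [n.+2] is odd, one of
   them is even. *)
have sumE : ((x + z)%N%:R = x + z :> 'Z_n.+2)%R by rewrite natrD !natr_Zp.
case: (boolP (odd (x + z))) => [xz_odd|xz_even]; last exact: (Zp_half xz_even).
apply: (@Zp_half _ _ (x + z + n.+2)); first by rewrite oddD xz_odd /= n_odd.
by rewrite natrD sumE pchar_Zp // addr0.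
Qed.

(** Parity of the canonical representative; it is additive only when the modulus is even. *)
Definition Zp_odd n (x : 'Z_n) : bool := odd x.

Lemma dihedral_edge_even n (x z : vertex (dihedral_graph n.+2)) :
  ~~ odd n -> edge x z <-> Zp_odd x = Zp_odd z.
Proof.
move=> n_even; have n2_even : odd n.+2 = false by rewrite /= negbK; apply/negbTE.
rewrite dihedral_edgeE /Zp_odd; split=> [[y xzE]|xz].
  have: odd (x + z) = odd (y + y).
    (* Reduction modulo an even number keeps parity, so the equation between residues can be read in
       [nat]. *)
    rewrite -(odd_mod _ n2_even) -[RHS](odd_mod _ n2_even).
    by move: xzE; rewrite mulr2n => /(congr1 (fun u : 'I_n.+2 => odd u)).
  by rewrite !oddD addbb; case: (odd x) (odd z) => [] [].
apply: (@Zp_half _ _ (x + z)); first by rewrite oddD xz addbb.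
by rewrite natrD !natr_Zp.
Qed.

Lemma ltn_bit_double m i (b : bool) : i < m -> b + i.*2 < m.*2.
Proof. by case: b; rewrite ?ltn_Sdouble ?ltn_double. Qed.

Definition parity_class n : bool -> set (vertex (dihedral_graph n.+2)) :=
  @level_set (dihedral_graph n.+2) (@Zp_odd n.+2).
Arguments parity_class : clear implicits.

(** Halving representatives numbers the class; its inverse is [i] to [b + i.*2], which stays in
    range because [n.+2] is even. *)
Lemma parity_class_complete n b :
  ~~ odd n ->
  digraph_isomorphic
    (induced_subgraph (parity_class n b)) (complete_digraph (n.+2 %/ 2)).
Proof.
move=> n_even; rewrite divn2.
have nE : (n.+2)./2.*2 = n.+2 by rewrite even_halfK //= negbK.
have half_lt (x : 'I_n.+2) : x./2 < n.+2./2 by rewrite ltn_half_double nE.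
have lift_lt (i : 'I_(n.+2./2)) : b + i.*2 < n.+2.
  by rewrite -[X in _ < X]nE ltn_bit_double.
have lift_in i : (Ordinal (lift_lt i) : vertex (dihedral_graph n.+2))
    \in parity_class n b.
  apply/mem_set; rewrite /parity_class /level_set /Zp_odd /=.
  by rewrite oddD odd_double addbF oddb.
exists (fun x => Ordinal (half_lt (sval x))); split.
  pose g i := exist (fun x => x \in parity_class n b) _ (lift_in i).
  exists g => [[x xb]|i].
    (* The first [val_inj] drops the membership proof, the second the bound of the ordinal. *)
    apply: val_inj; apply: val_inj => /=.
    by rewrite -(set_mem xb : odd x = b) odd_double_half.
  by apply: val_inj; rewrite /= half_bit_double.
move=> [x xb] [y yb]; split=> // _; apply/dihedral_edge_even => //=.
by rewrite (set_mem xb) (set_mem yb).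
Qed.

Theorem proposition3p4 (n : nat) (hn : 2 <= n) :
  digraph_symmetric (cayley_graph (dihedral_quandle n)) /\
  (odd n ->
     digraph_isomorphic (cayley_graph (dihedral_quandle n))
       (complete_digraph n)) /\
  (~~ odd n ->
     (connected_components (cayley_graph (dihedral_quandle n)) #= `I_2)%card /\
     forall S : set (vertex (cayley_graph (dihedral_quandle n))),
       connected_components (cayley_graph (dihedral_quandle n)) S ->
       digraph_isomorphic (induced_subgraph S) (complete_digraph (n %/ 2))).
Proof.
(* With the modulus in the form [n.+2], ['Z_n.+2] computes to ['I_n.+2], and [n] has the same parity
   as the modulus. *)
case: n hn => [|[|n]] // _; rewrite [odd _]/= negbK.
split; last split=> [n_odd|n_even].
- by move=> x z /dihedral_edgeE[y xzE]; apply/dihedral_edgeE; exists y; rewrite addrC.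
- exists id; split; first by exists id.
  by move=> x y; split=> // _; apply: dihedral_edge_odd.
have edgeE (x z : vertex (dihedral_graph n.+2)) := dihedral_edge_even x z n_even.
have odd_surj b : exists x : vertex (dihedral_graph n.+2), Zp_odd x = b.
  (* The residues 0 and 1 realise the two parities. *)
  by exists (inord b); rewrite /Zp_odd inordK; case: b.
split; first exact: connected_components_card edgeE odd_surj.
by move=> S /(componentP edgeE odd_surj)[b ->]; apply: parity_class_complete.
Qed.
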